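(* Let $\alpha>0$, $\beta>0$, $\kappa>0$ be real numbers and let $c=\frac{36\alpha^2}{169\beta}$. Then $$u(x,t)=\frac{105\,\alpha^2}{169\,\kappa\beta}\,\mathrm{sech}^4\left[\frac12\sqrt{\frac{\alpha}{13\beta}}\left(x-\frac{36\alpha^2}{169\beta}\,t\right)\right]$$ is a solution on $\mathbb R^2$ of the Kawahara equation $$u_t+\kappa u u_x+\alpha u_{xxx}-\beta u_{xxxxx}=0$$ with zero boundary condition, i.e. as a function of $\xi=x-ct$ it satisfies $$-cu+\tfrac{\kappa}{2}u^2+\alpha u_{\xi\xi}-\beta u_{\xi\xi\xi\xi}=0 .$$
   Context: For a traveling wave $u(\xi)$, $\xi=x-ct$, the Kawahara equation integrates once to $-cu+\frac{\kappa}{2}u^2+\alpha u_{\xi\xi}-\beta u_{\xi\xi\xi\xi}=\mathcal A$ with a constant $\mathcal A$; ''zero boundary condition'' means $\mathcal A=0$. *)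

(* Defs.v *)
From Stdlib Require Import Reals.
From Coquelicot Require Import Coquelicot.
Open Scope R_scope.

Definition sech (y : R) : R := / cosh y.

(* Pitfall: [Derive_n] is total and [ex_derive_n f n] only speaks of the last
   differentiation step, so every order up to the one used is required. *)
Definition differentiable_upto (n : nat) (f : R -> R) : Prop :=
  forall k : nat, (k <= n)%nat -> forall y : R, ex_derive_n f k y.

Definition dt (u : R -> R -> R) (x t : R) : R := Derive (fun s => u x s) t.

Definition dx (n : nat) (u : R -> R -> R) (x t : R) : R :=
  Derive_n (fun y => u y t) n x.

Definition jointly_continuous (v : R -> R -> R) : Prop :=
  forall p : R * R, continuous (fun q : R * R => v (fst q) (snd q)) p.

(* Classical solution on the whole plane:
   u_t + kappa u u_x + alpha u_xxx - beta u_xxxxx = 0, where u_t and the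
   x-derivatives up to order five exist and are continuous in (x, t). *)
Definition kawahara_solution (alpha beta kappa : R) (u : R -> R -> R) : Prop :=
  (forall x t : R, ex_derive (fun s => u x s) t) /\
  (forall t : R, differentiable_upto 5 (fun x => u x t)) /\
  jointly_continuous (dt u) /\
  (forall k : nat, (k <= 5)%nat -> jointly_continuous (dx k u)) /\
  (forall x t : R,
     dt u x t + kappa * u x t * dx 1 u x t
       + alpha * dx 3 u x t - beta * dx 5 u x t = 0).

(* The once-integrated equation for a wave profile U(xi), xi = x - c t, with
   constant of integration A; "zero boundary condition" is A = 0. *)
Definition integrated_kawahara (alpha beta kappa c A : R) (U : R -> R) : Prop :=
  differentiable_upto 4 U /\
  (forall xi : R,
     - c * U xi + kappa / 2 * U xi ^ 2
       + alpha * Derive_n U 2 xi - beta * Derive_n U 4 xi = A).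

(* Main.v *)
Require Import Defs.
From Stdlib Require Import Reals Wf_nat Lra Lia.
From Coquelicot Require Import Coquelicot.
Open Scope R_scope.

(** Twice differentiating [sech ^ n] gives [n^2 sech^n - n (n + 1) sech^(n+2)],
    so the powers of [sech] are smooth, and for [U = a sech^4 (k xi)] the
    integrated equation is a polynomial in [sech^2] whose coefficients in degrees
    4, 6 and 8 vanish for the given [c], [k] and [a].  The Kawahara
    equation is the derivative of the integrated equation along [xi = x - c t]. *)

(** All orders are required at once, so that passing to a derivative needs no count of how many
    orders remain. *)
Definition smooth (f : R -> R) : Prop :=
  forall (n : nat) (y : R), ex_derive_n f n y.

Lemma smooth_differentiable_upto (n : nat) (f : R -> R) :
  smooth f -> differentiable_upto n f.
Proof. intros Hf k _ y; apply Hf. Qed.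

Lemma smooth_locally (f : R -> R) (n : nat) (x : R) :
  smooth f -> locally x (fun y => forall k, (k <= n)%nat -> ex_derive_n f k y).
Proof. intros Hf; apply filter_forall; intros y k _; apply Hf. Qed.

Lemma smooth_ex_derive (f : R -> R) (n : nat) (x : R) :
  smooth f -> ex_derive (Derive_n f n) x.
Proof. intros Hf; exact (Hf (S n) x). Qed.

Lemma smooth_scal_l (a : R) (f : R -> R) : smooth f -> smooth (fun y => a * f y).
Proof. intros Hf n y; apply ex_derive_n_scal_l, Hf. Qed.

Lemma smooth_comp_scal (a : R) (f : R -> R) : smooth f -> smooth (fun y => f (a * y)).
Proof. intros Hf n y; apply ex_derive_n_comp_scal, smooth_locally, Hf. Qed.

(** * Travelling waves *)

Lemma dx_travelling_wave (U : R -> R) (c x t : R) (n : nat) :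
  dx n (fun x t => U (x - c * t)) x t = Derive_n U n (x - c * t).
Proof. exact (Derive_n_comp_trans U n x (- (c * t))). Qed.

Lemma is_derive_travelling_wave_time (U : R -> R) (c x t : R) :
  smooth U ->
  is_derive (fun s => U (x - c * s)) t (- c * Derive_n U 1 (x - c * t)).
Proof.
  intros HU.
  apply (is_derive_comp U (fun s => x - c * s)).
  - apply Derive_correct, (HU 1%nat).
  - auto_derive; [exact I | ring].
Qed.

Lemma jointly_continuous_travelling_wave (f : R -> R) (c : R) :
  (forall y, ex_derive f y) -> jointly_continuous (fun x t => f (x - c * t)).
Proof.
  intros Hf p.
  apply (continuous_comp (fun q : R * R => fst q - c * snd q) f).
  - apply (continuous_minus (V := R_NormedModule) (fun q : R * R => fst q)
             (fun q : R * R => c * snd q)).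
    + apply continuous_fst.
    + apply (continuous_scal_r (V := R_NormedModule) c (fun q : R * R => snd q)).
      apply continuous_snd.
  - exact (ex_derive_continuous (V := R_NormedModule) f _ (Hf _)).
Qed.

Lemma jointly_continuous_ext (v w : R -> R -> R) :
  (forall x t, v x t = w x t) -> jointly_continuous v -> jointly_continuous w.
Proof.
  intros Hvw Hv p.
  apply continuous_ext with (2 := Hv p); intros q; apply Hvw.
Qed.

(** The left side of the integrated equation is the constant [A], so its derivative vanishes; the
    factor 1/2 cancels against the 2 from differentiating [U ^ 2]. *)
Lemma integrated_kawahara_derive (alpha beta kappa c A : R) (U : R -> R) (y : R) :
  smooth U -> integrated_kawahara alpha beta kappa c A U ->
  - c * Derive_n U 1 y + kappa * U y * Derive_n U 1 y
    + alpha * Derive_n U 3 y - beta * Derive_n U 5 y = 0.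
Proof.
  intros HU [_ HA].
  assert (H0 := smooth_ex_derive U 0 y HU).
  assert (H2 := smooth_ex_derive U 2 y HU).
  assert (H4 := smooth_ex_derive U 4 y HU).
  assert (Hd : is_derive (fun xi => - c * U xi + kappa / 2 * U xi ^ 2
       + alpha * Derive_n U 2 xi - beta * Derive_n U 4 xi) y
     (- c * Derive_n U 1 y + kappa * U y * Derive_n U 1 y
       + alpha * Derive_n U 3 y - beta * Derive_n U 5 y)).
  { change (ex_derive U y) in H0.
    change (Derive_n U 1 y) with (Derive U y).
    change (Derive_n U 3 y) with (Derive (Derive_n U 2) y).
    change (Derive_n U 5 y) with (Derive (Derive_n U 4) y).
    (* The higher derivatives become opaque functions, so that [auto_derive] treats them as atoms
       with the differentiability in [H2] and [H4]. *)
    set (g := Derive_n U 2) in *; set (h := Derive_n U 4) in *.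
    clearbody g h.
    auto_derive; [now repeat split | ].
    change (Derive (fun x => U x) y) with (Derive U y).
    change (Derive (fun x => g x) y) with (Derive g y).
    change (Derive (fun x => h x) y) with (Derive h y).
    field. }
  apply is_derive_unique in Hd; rewrite <- Hd.
  rewrite (Derive_ext _ (fun _ => A)); [apply Derive_const | exact HA].
Qed.

(** Since [u_t = - c * U'], the Kawahara equation at [(x, t)] is the differentiated profile equation
    at [x - c * t]. Joint continuity holds because each derivative of [U] is itself differentiable,
    hence continuous. *)
Lemma travelling_wave_kawahara_solution (alpha beta kappa c A : R) (U : R -> R) :
  smooth U -> integrated_kawahara alpha beta kappa c A U ->
  kawahara_solution alpha beta kappa (fun x t => U (x - c * t)).
Proof.
  intros HU HI.
  assert (Hdt : forall x t, dt (fun x t => U (x - c * t)) x t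
                            = - c * Derive_n U 1 (x - c * t)).
  { intros x t; apply is_derive_unique, is_derive_travelling_wave_time, HU. }
  repeat split.
  - intros x t; eexists; apply is_derive_travelling_wave_time, HU.
  - intros t k _ x.
    apply (ex_derive_n_comp_trans U k x (- (c * t))), HU.
  - apply (jointly_continuous_ext (fun x t => - c * Derive_n U 1 (x - c * t))).
    + intros x t; symmetry; apply Hdt.
    + apply (jointly_continuous_travelling_wave (fun y => - c * Derive_n U 1 y)).
      intros y; apply ex_derive_scal, smooth_ex_derive, HU.
  - intros k _.
    apply (jointly_continuous_ext (fun x t => Derive_n U k (x - c * t))).
    + intros x t; symmetry; apply dx_travelling_wave.
    + apply (jointly_continuous_travelling_wave (Derive_n U k)).
      intros y; apply smooth_ex_derive, HU.
  - intros x t.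
    rewrite Hdt, !dx_travelling_wave.
    apply (integrated_kawahara_derive _ _ _ c A); assumption.
Qed.

(** * Powers of the hyperbolic secant *)

Lemma cosh_gt_0 (y : R) : 0 < cosh y.
Proof. unfold cosh; generalize (exp_pos y) (exp_pos (- y)); lra. Qed.

Lemma sech2_add_tanh2 (y : R) : sech y ^ 2 + tanh y ^ 2 = 1.
Proof.
  assert (Hc := cosh_gt_0 y).
  unfold sech, tanh.
  replace 1 with ((cosh y ^ 2 - sinh y ^ 2 + sinh y ^ 2) / cosh y ^ 2)
    by (field; lra).
  replace (cosh y ^ 2 - sinh y ^ 2) with 1; [field; lra | ].
  unfold cosh, sinh; rewrite exp_Ropp; field.
  apply Rgt_not_eq, exp_pos.
Qed.

Lemma is_derive_cosh (y : R) : is_derive cosh y (sinh y).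
Proof. apply is_derive_Reals, derivable_pt_lim_cosh. Qed.

Lemma is_derive_sinh (y : R) : is_derive sinh y (cosh y).
Proof. apply is_derive_Reals, derivable_pt_lim_sinh. Qed.

Lemma is_derive_sech (y : R) : is_derive sech y (- (sech y * tanh y)).
Proof.
  assert (Hc := cosh_gt_0 y).
  replace (- (sech y * tanh y)) with (- sinh y / cosh y ^ 2)
    by (unfold sech, tanh; field; lra).
  apply is_derive_inv; [apply is_derive_cosh | lra].
Qed.

Lemma is_derive_tanh (y : R) : is_derive tanh y (sech y ^ 2).
Proof.
  assert (Hc := cosh_gt_0 y).
  replace (sech y ^ 2) with ((cosh y * cosh y - sinh y * sinh y) / cosh y ^ 2).
  - apply is_derive_div; [apply is_derive_sinh | apply is_derive_cosh | lra].
  - transitivity (1 - tanh y ^ 2).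
    + unfold tanh; field; lra.
    + rewrite <- (sech2_add_tanh2 y); ring.
Qed.

Lemma is_derive_sech_pow (n : nat) (y : R) :
  is_derive (fun z => sech z ^ n) y (- INR n * (sech y ^ n * tanh y)).
Proof.
  replace (- INR n * (sech y ^ n * tanh y))
    with (INR n * - (sech y * tanh y) * sech y ^ pred n).
  - apply is_derive_pow, is_derive_sech.
  (* The case [n = 0] is separate because [pred 0] is 0; there the factor [INR n] kills both
     sides. *)
  - destruct n as [| n]; [simpl; ring | ].
    change (pred (S n)) with n; rewrite <- tech_pow_Rmult; ring.
Qed.

(** The second derivative contains [tanh] only squared, and [tanh ^ 2 = 1 - sech ^ 2] turns it back
    into powers of [sech]. *)
Lemma Derive_2_sech_pow (n : nat) (y : R) :
  Derive_n (fun z => sech z ^ n) 2 y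
  = INR n ^ 2 * sech y ^ n - INR n * (INR n + 1) * sech y ^ (n + 2).
Proof.
  simpl Derive_n.
  rewrite (Derive_ext _ (fun z => - INR n * (sech z ^ n * tanh z)))
    by (intros z; apply is_derive_unique, is_derive_sech_pow).
  apply is_derive_unique.
  replace (INR n ^ 2 * sech y ^ n - INR n * (INR n + 1) * sech y ^ (n + 2))
    with (- INR n * (- INR n * (sech y ^ n * tanh y) * tanh y
                     + sech y ^ n * sech y ^ 2)).
  - apply is_derive_scal.
    apply (is_derive_mult (fun z => sech z ^ n) tanh);
      [apply is_derive_sech_pow | apply is_derive_tanh | apply Rmult_comm].
  - rewrite pow_add.
    replace (- INR n * (sech y ^ n * tanh y) * tanh y)
      with (- INR n * sech y ^ n * tanh y ^ 2) by ring.
    replace (tanh y ^ 2) with (1 - sech y ^ 2)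
      by (rewrite <- (sech2_add_tanh2 y); ring).
    ring.
Qed.

(** Strong induction on the order, for all exponents together: two differentiations lower the order
    by two but bring in the exponent [n + 2]. *)
Lemma smooth_sech_pow (n : nat) : smooth (fun z => sech z ^ n).
Proof.
  intros m; revert n.
  induction m as [m IH] using lt_wf_ind; intros n y.
  (* Order 2 is a base case too: it asks that the first derivative be differentiable, which the
     value of the total [Derive_n] at order 2 does not give. *)
  destruct m as [| [| [| m]]].
  - exact I.
  - eexists; apply is_derive_sech_pow.
  - apply (ex_derive_ext (fun z => - INR n * (sech z ^ n * tanh z))).
    + intros z; symmetry; apply is_derive_unique, is_derive_sech_pow.
    + apply ex_derive_scal, ex_derive_mult;
        eexists; [apply is_derive_sech_pow | apply is_derive_tanh].
  - apply (ex_derive_ext (Derive_n (Derive_n (fun z => sech z ^ n) 2) m)).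
    { intros z; rewrite Derive_n_comp; f_equal; lia. }
    change (ex_derive_n (Derive_n (fun z => sech z ^ n) 2) (S m) y).
    apply (ex_derive_n_ext (fun z => INR n ^ 2 * sech z ^ n
             - INR n * (INR n + 1) * sech z ^ (n + 2))).
    { intros z; symmetry; apply Derive_2_sech_pow. }
    apply ex_derive_n_minus; apply filter_forall; intros z k Hk;
      apply ex_derive_n_scal_l, IH; lia.
Qed.

Lemma Derive_4_sech_pow (n : nat) (y : R) :
  Derive_n (fun z => sech z ^ n) 4 y
  = INR n ^ 2 * Derive_n (fun z => sech z ^ n) 2 y
    - INR n * (INR n + 1) * Derive_n (fun z => sech z ^ (n + 2)) 2 y.
Proof.
  change 4%nat with (2 + 2)%nat; rewrite <- Derive_n_comp.
  rewrite (Derive_n_ext _ (fun z => INR n ^ 2 * sech z ^ n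
             - INR n * (INR n + 1) * sech z ^ (n + 2)))
    by (intros z; apply Derive_2_sech_pow).
  (* Linearity of [Derive_n] requires both terms to be differentiable near the point, which
     smoothness supplies. *)
  rewrite Derive_n_minus by
    (apply smooth_locally, smooth_scal_l, smooth_sech_pow).
  rewrite !Derive_n_scal_l; reflexivity.
Qed.

(** * The scaled profile and its equation *)

Lemma Derive_n_sech_pow_profile (a k : R) (m n : nat) (y : R) :
  Derive_n (fun xi => a * sech (k * xi) ^ m) n y
  = a * (k ^ n * Derive_n (fun z => sech z ^ m) n (k * y)).
Proof.
  rewrite Derive_n_scal_l.
  rewrite (Derive_n_comp_scal (fun z => sech z ^ m))
    by apply smooth_locally, smooth_sech_pow.
  reflexivity.
Qed.

Lemma smooth_sech_pow_profile (a k : R) (m : nat) :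
  smooth (fun xi => a * sech (k * xi) ^ m).
Proof.
  apply smooth_scal_l, (smooth_comp_scal k (fun z => sech z ^ m)), smooth_sech_pow.
Qed.

(** With [a] the amplitude and [s = sech (k * xi)], dividing by [a] leaves the coefficients [- c +
    16 * alpha * k^2 - 256 * beta * k^4] of [s^4], [- 20 * alpha * k^2 + 1040 * beta * k^4] of [s^6]
    and [kappa * a / 2 - 840 * beta * k^4] of [s^8]. The middle one forces the value of [k^2] when
    [k] is nonzero; the others then give [c] and [a]. *)
Lemma sech4_integrated_kawahara (alpha beta kappa k : R) :
  beta <> 0 -> kappa <> 0 -> k ^ 2 = alpha / (52 * beta) ->
  integrated_kawahara alpha beta kappa (36 * alpha ^ 2 / (169 * beta)) 0
    (fun xi => 105 * alpha ^ 2 / (169 * kappa * beta) * sech (k * xi) ^ 4).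
Proof.
  intros Hbeta Hkappa Hk.
  split; [apply smooth_differentiable_upto, smooth_sech_pow_profile | ].
  intros xi.
  rewrite !Derive_n_sech_pow_profile, Derive_4_sech_pow, !Derive_2_sech_pow.
  (* Only even powers of [k] occur, so [Hk] eliminates [k] without any square root. *)
  replace (k ^ 4) with ((k ^ 2) ^ 2) by ring.
  rewrite Hk; simpl; field; split; assumption.
Qed.

Theorem mainTheorem2 (alpha beta kappa : R)
    (Halpha : 0 < alpha) (Hbeta : 0 < beta) (Hkappa : 0 < kappa) :
  let c := 36 * alpha ^ 2 / (169 * beta) in
  let u := fun x t : R =>
    105 * alpha ^ 2 / (169 * kappa * beta)
    * sech (1 / 2 * sqrt (alpha / (13 * beta))
            * (x - 36 * alpha ^ 2 / (169 * beta) * t)) ^ 4 in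
  kawahara_solution alpha beta kappa u /\
  exists U : R -> R,
    (forall x t : R, u x t = U (x - c * t)) /\
    integrated_kawahara alpha beta kappa c 0 U.
Proof.
  intros c u.
  set (k := 1 / 2 * sqrt (alpha / (13 * beta))) in u.
  set (U := fun xi => 105 * alpha ^ 2 / (169 * kappa * beta) * sech (k * xi) ^ 4).
  assert (HI : integrated_kawahara alpha beta kappa c 0 U).
  { apply sech4_integrated_kawahara; [lra | lra | ].
    (* Squaring gives [1/4 * (alpha / (13 * beta))], which is [alpha / (52 * beta)]; the radicand
       must be shown nonnegative. *)
    unfold k; rewrite Rpow_mult_distr, pow2_sqrt.
    - field; lra.
    - apply Rlt_le, Rdiv_lt_0_compat; lra. }
  split.
  - apply (travelling_wave_kawahara_solution _ _ _ c 0 U);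
      [apply smooth_sech_pow_profile | exact HI].
  - exists U; split; [reflexivity | exact HI].
Qed.
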